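(* Let $d,k \ge 1$ be fixed integers. Suppose that $X, X_1, X_2, \dots$ is a sequence of i.i.d. $\mathbb{C}^{d \times d}$-valued random variables such that $$\mathbb{E} \left[ \Vert X \Vert_{HS}^{2k} \mathbf{1}( \Vert X \Vert_{HS}^{2k} >R ) \right] \to 0 \quad \text{as } R \to \infty,$$ and define $a_n := \mathbb{E} \left[ \Vert X_1 \cdots X_n \Vert_{HS}^{2k} \right]$ for $n \in \mathbb{N}$. Then the sequence $(a_n)_n$ satisfies a linear recurrence of length $$l^{\mathbb{C}} := \binom{k+d^2-1}{k}.$$ If the random variables are in fact $\mathbb{R}^{d \times d}$-valued, then the sequence $(a_n)_n$ satisfies a linear recurrence of length $$l^{\mathbb{R}} := \binom{k+\binom{d+1}{2}-1}{k}.$$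
   Context: $\mathbb{N} = \{1,2,3,\dots\}$. $\Vert A \Vert_{HS}$ is the Hilbert-Schmidt norm, $\Vert A \Vert_{HS}^2 = \mathrm{Tr}(A^* A)$ for $A \in \mathbb{C}^{d\times d}$. $\mathbf{1}(E)$ is the indicator function of an event $E$. A sequence $(a_n)_{n \in \mathbb{N}}$ satisfies a linear recurrence of length $l$ if there are constants $c_1, \dots, c_l \in \mathbb{C}$ (independent of $n$) such that $a_{n+l} + c_1 a_{n+l-1} + \dots + c_l a_n = 0$ for all $n \in \mathbb{N}$. *)

(* Defs.v *)
From HB Require Import structures.
From mathcomp Require Export all_boot all_order all_algebra.
From mathcomp Require Export finmap complex.
From mathcomp Require Export all_classical all_reals all_analysis.

Set Implicit Arguments.
Unset Strict Implicit.
Unset Printing Implicit Defensive.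

Export Order.TTheory GRing.Theory Num.Theory.
Export numFieldNormedType.Exports.

Local Open Scope classical_set_scope.
Local Open Scope ring_scope.
Local Open Scope complex_scope.
Local Open Scope sesquilinear_scope.

(* The topology of the complex numbers is the one of the modulus, which every
   numFieldType carries; this makes it visible on the type R[i], and hence
   gives the entrywise (that is, Euclidean) topology on matrices over R[i]. *)
HB.instance Definition _ (R : realType) := NormedModule.copy R[i] R[i]^o.

Notation borel_mx R d := (g_sigma_algebraType (@open 'M[R[i]]_d)).

(* \tr (A ^t* *m A) is a nonnegative real; Re only changes its type. *)
Definition hs_norm (R : realType) (d : nat) (A : 'M[R[i]]_d) : R :=
  Num.sqrt (complex.Re (\tr (A ^t* *m A))).

(* A measure is a total function on sets, with no meaning outside the
   measurable ones, so laws are compared on measurable sets only. *)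
Definition identically_distributed (disp disp' : measure_display)
    (T : measurableType disp) (T' : measurableType disp') (R : realType)
    (P : probability T R) (X : nat -> {RV P >-> T'}) : Prop :=
  forall (i j : nat) (B : set T'), measurable B ->
    distribution P (X i) B = distribution P (X j) B.

Definition mutually_independent (disp disp' : measure_display)
    (T : measurableType disp) (T' : measurableType disp') (R : realType)
    (P : probability T R) (X : nat -> {RV P >-> T'}) : Prop :=
  forall (J : {fset nat}) (B : nat -> set T'),
    (forall j, j \in J -> measurable (B j)) ->
    P (\bigcap_(j in [set` J]) (X j @^-1` B j)) =
    (\prod_(j <- J) P (X j @^-1` B j))%E.

Definition iid (disp disp' : measure_display)
    (T : measurableType disp) (T' : measurableType disp') (R : realType)
    (P : probability T R) (X : nat -> {RV P >-> T'}) : Prop :=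
  mutually_independent X /\ identically_distributed X.

Definition tail_moment (disp : measure_display) (T : measurableType disp)
    (R : realType) (P : probability T R) (d k : nat)
    (X : {RV P >-> borel_mx R d}) (r : R) : \bar R :=
  ('E_P[(fun w => hs_norm (X w : 'M[R[i]]_d) ^+ (2 * k) *
           \1_[set v | r < hs_norm (X v : 'M[R[i]]_d) ^+ (2 * k)] w)%R])%E.

(* X 0 is not a factor: it plays the role of the generic copy X in the
   sequence X, X_1, X_2, ...  The value may a priori be +oo. *)
Definition product_moment (disp : measure_display) (T : measurableType disp)
    (R : realType) (P : probability T R) (d k : nat)
    (X : nat -> {RV P >-> borel_mx R d}) (n : nat) : \bar R :=
  ('E_P[(fun w => hs_norm (\prod_(1 <= i < n.+1) (X i w : 'M[R[i]]_d))
                    ^+ (2 * k))%R])%E.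

(* Sequences are indexed from 1: the value a 0 plays no role. *)
Definition satisfies_linear_recurrence (K : pzRingType) (l : nat)
    (a : nat -> K) : Prop :=
  exists c : nat -> K, forall n : nat, (1 <= n)%N ->
    a (n + l)%N + \sum_(1 <= i < l.+1) c i * a (n + l - i)%N = 0.

(* Main.v *)
Require Import Defs.
From mathcomp Require Import measurable_realfun zify.

(* The k-fold products of the entries of a matrix H span a space of homogeneous
   polynomials on which A acts through H |-> A H A^*: the vector of these
   products at A H A^* is a matrix W(A) times the vector at H.  As
   |X_1 ... X_n|^(2k) = (tr H)^k for H = (X_1 ... X_n) I (X_1 ... X_n)^*, this
   moment is u W(X_1) ... W(X_n) v, whose expectation is u (E W)^n v by
   independence, and Cayley-Hamilton for E W gives the recurrence.  Its length
   is the number of degree k monomials in the entries: there are d^2 of them in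
   general, and binomial(d + 1, 2) when all the H involved are symmetric. *)

Set Implicit Arguments.
Unset Strict Implicit.
Unset Printing Implicit Defensive.

Local Open Scope ring_scope.
Local Open Scope complex_scope.
Local Open Scope sesquilinear_scope.

(** * The action of congruences on monomials *)

(** Cayley-Hamilton for [M], multiplied by [M ^+ n] and placed between [u] and [v], is the
    recurrence. The characteristic polynomial is monic of degree [l], so the leading term is
    [a (n + l)] itself. *)
Lemma linear_recurrence_mxpow (K : comNzRingType) (l : nat) (M : 'M[K]_l)
    (u : 'rV[K]_l) (v : 'cV[K]_l) :
  satisfies_linear_recurrence l (fun n => (u *m M ^+ n *m v) 0 0).
Proof.
have CH : \sum_(j < l.+1) (char_poly M)`_j *: M ^+ j = 0.
  case: l M {u v} => [|l] M; first by rewrite flatmx0 [RHS]flatmx0.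
  rewrite -[RHS](Cayley_Hamilton M) -[in RHS](coefK (char_poly M)) poly_def.
  rewrite size_char_poly rmorph_sum; apply: eq_bigr => j _.
  by rewrite /= horner_mxZ rmorphXn/= horner_mx_X.
(* The recurrence numbers its coefficients down from the leading term: the one of [a (n + l - i)]
   has degree [l - i] in the polynomial. *)
exists (fun i => (char_poly M)`_(l - i)) => n _.
pose a n := (u *m M ^+ n *m v) 0 0.
have sum0 : \sum_(j < l.+1) (char_poly M)`_j * a (n + j)%N = 0.
  transitivity
    ((u *m M ^+ n *m (\sum_(j < l.+1) (char_poly M)`_j *: M ^+ j) *m v) 0 0).
    rewrite mulmx_sumr mulmx_suml summxE; apply: eq_bigr => j _.
    by rewrite /a exprD -mulmxE -scalemxAr -scalemxAl [RHS]mxE !mulmxA.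
  by rewrite CH mulmx0 mul0mx mxE.
have lead : (char_poly M)`_l = 1.
  have /monicP := char_poly_monic M.
  by rewrite /lead_coef size_char_poly.
rewrite -[RHS]sum0 big_ord_recr/= lead mul1r addrC; congr (_ + _).
rewrite big_add1/= big_mkord (reindex_inj rev_ord_inj)/=.
apply: eq_bigr => j _; rewrite -/(a _); congr (_ * a _).
  by congr (_`_ _); have := ltn_ord j; lia.
by have := ltn_ord j; lia.
Qed.

Section MonomialAction.
Variables (R : realType) (d k m : nat).
Notation C := R[i].
Notation pair := ('I_d * 'I_d)%type.
(* Positions that carry equal entries are grouped into m.+1 classes: e p is the
   class of p, and r c a representative of c.  Products of k entries are then
   indexed by the sorted k-tuples of classes. *)
Variables (e : pair -> 'I_m.+1) (r : 'I_m.+1 -> pair).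

Notation multi := {ffun 'I_k -> pair}.
Definition sorted_tuples := [set t : k.-tuple 'I_m.+1 | sorted leq (map val t)].
Notation l := #|sorted_tuples|.

Definition sort_ord (t : k.-tuple 'I_m.+1) : k.-tuple 'I_m.+1 :=
  [tuple of sort (fun i j : 'I_m.+1 => (i <= j)%N) t].

Lemma sort_ord_sorted t : sort_ord t \in sorted_tuples.
Proof.
rewrite inE/= sorted_map; apply: sort_sorted => i j; exact: leq_total.
Qed.

(** Two multi-indices have the same class when their positions have the same classes up to order;
    the sorted tuple is the canonical form. *)
Definition multi_class (t : multi) : 'I_l :=
  enum_rank_in (sort_ord_sorted [tuple e (t i) | i < k])
               (sort_ord [tuple e (t i) | i < k]).

Definition multi_repr (a : 'I_l) : multi := [ffun i => r (tnth (enum_val a) i)].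

Definition monomial (H : 'M[C]_d) (t : multi) : C :=
  \prod_(i < k) H (t i).1 (t i).2.

Definition monomials (H : 'M[C]_d) : 'cV[C]_l :=
  \col_a monomial H (multi_repr a).

Definition class_invariant (H : 'M[C]_d) :=
  forall p, H (r (e p)).1 (r (e p)).2 = H p.1 p.2.

(** Sorting only permutes commuting factors, and invariance lets each position be exchanged for the
    representative of its class. *)
Lemma monomial_multi_class H t : class_invariant H ->
  monomial H (multi_repr (multi_class t)) = monomial H t.
Proof.
move=> invH; rewrite /monomial /multi_repr /multi_class.
under eq_bigr do rewrite ffunE.
rewrite enum_rankK_in ?sort_ord_sorted//.
rewrite -(big_tuple _ _ (sort_ord _) xpredT (fun j => H (r j).1 (r j).2)).
rewrite (perm_big [tuple e (t i) | i < k]) ?perm_sort//= big_map big_enum.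
by apply: eq_bigr => i _; rewrite invH.
Qed.

(** The coefficients found by expanding the monomials of [A *m H *m A ^t*] in the entries of [H] and
    collecting terms by class. When each position is its own class, this is the [k]-th symmetric
    power of the congruence by [A], in the monomial basis. *)
Definition transfer_mx (A : 'M[C]_d) : 'M[C]_l :=
  \matrix_(a, b) \sum_(t | multi_class t == b)
    \prod_(i < k) (A (multi_repr a i).1 (t i).1 *
                   Num.conj (A (multi_repr a i).2 (t i).2)).

Lemma congr_mxE (A H : 'M[C]_d) p :
  (A *m H *m A ^t*) p.1 p.2 =
  \sum_(q : pair) A p.1 q.1 * Num.conj (A p.2 q.2) * H q.1 q.2.
Proof.
rewrite -(pair_bigA _ (fun i j => A p.1 i * Num.conj (A p.2 j) * H i j))/=.
rewrite mxE exchange_big/=; apply: eq_bigr => i _.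
rewrite mxE mulr_suml; apply: eq_bigr => j _.
by rewrite !mxE mulrAC.
Qed.

Lemma monomials_congr A H : class_invariant H ->
  monomials (A *m H *m A ^t*) = transfer_mx A *m monomials H.
Proof.
move=> invH; apply/matrixP => a j; rewrite (ord1 j) [LHS]mxE [RHS]mxE {j}.
rewrite /monomial; under eq_bigr do rewrite congr_mxE.
(* Distributivity turns the product of [k] sums over positions into one sum over all multi-indices,
   which is then split by class. *)
rewrite bigA_distr_bigA/=.
under eq_bigr do rewrite big_split/= -/(monomial H _).
rewrite (partition_big multi_class predT)//=; apply: eq_bigr => b _.
rewrite !mxE mulr_suml; apply: eq_bigr => t /eqP tb.
by rewrite -tb monomial_multi_class.
Qed.

(** The last factor of the product is the innermost and acts on [H] first, so the induction absorbs
    it into [H], which must stay general. *)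
Lemma inv_congr_prod (A : nat -> 'M[C]_d) (inv : 'M[C]_d -> Prop) n H :
  (forall i B, inv B -> inv (A i *m B *m (A i) ^t*)) -> inv H ->
  inv ((\prod_(1 <= i < n.+1) A i) *m H *m (\prod_(1 <= i < n.+1) A i) ^t*).
Proof.
move=> invA; elim: n H => [|n IHn] H invH.
  by rewrite !big_geq// trmx1 map_mx1 mulmx1 mul1mx.
have mulE (x y : 'M[C]_d) : x * y = x *m y by [].
rewrite !(big_nat_recr n.+1)//= !mulE trmx_mul map_mxM.
by have := IHn _ (invA n.+1 _ invH); rewrite !mulmxA.
Qed.

(** [monomials_congr] is applied at each factor in turn, so all intermediate matrices have to be
    class invariant; the stable property [inv] guarantees this. *)
Lemma monomials_congr_prod (A : nat -> 'M[C]_d) (inv : 'M[C]_d -> Prop) n H :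
  (forall B, inv B -> class_invariant B) ->
  (forall i B, inv B -> inv (A i *m B *m (A i) ^t*)) -> inv H ->
  monomials
    ((\prod_(1 <= i < n.+1) A i) *m H *m (\prod_(1 <= i < n.+1) A i) ^t*) =
  (\prod_(1 <= i < n.+1) transfer_mx (A i)) *m monomials H.
Proof.
move=> invC invA; elim: n H => [|n IHn] H invH.
  by rewrite !big_geq// trmx1 map_mx1 mulmx1 !mul1mx.
have mulE p (x y : 'M[C]_p) : x * y = x *m y by [].
rewrite !(big_nat_recr n.+1)//= !mulE trmx_mul map_mxM.
rewrite -(mulmxA _ _ (monomials H)) -monomials_congr; last exact: invC.
rewrite -IHn; last exact: invA.
by rewrite !mulmxA.
Qed.

Definition trace_row : 'rV[C]_l :=
  \row_a \sum_(f : {ffun 'I_k -> 'I_d} |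
               multi_class [ffun i => (f i, f i)] == a) 1.

(** Expanding the power gives one product of diagonal entries for each function [f]; [trace_row]
    counts these by class. *)
Lemma trace_exp H : class_invariant H ->
  (\tr H) ^+ k = (trace_row *m monomials H) 0 0.
Proof.
move=> invH; rewrite -[in LHS](card_ord k) -prodr_const.
rewrite /mxtrace bigA_distr_bigA/=.
rewrite (partition_big (fun f : {ffun 'I_k -> 'I_d} =>
  multi_class [ffun i => (f i, f i)]) predT)//= mxE.
apply: eq_bigr => a _; rewrite !mxE mulr_suml.
apply: eq_bigr => f /eqP <-; rewrite mul1r monomial_multi_class// /monomial.
by apply: eq_bigr => i _; rewrite ffunE.
Qed.

End MonomialAction.

Local Open Scope classical_set_scope.
Local Open Scope ring_scope.
Local Open Scope complex_scope.

(** * Products of independent random variables *)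

Section WeightedIntegral.
Import HBNNSimple.
Local Open Scope ereal_scope.
Context (disp disp' : measure_display) (T : measurableType disp)
  (T' : measurableType disp') (R : realType).
Variables (mu : {measure set T -> \bar R}) (X : T -> T').
Hypothesis mX : measurable_fun setT X.

Lemma nnsfun_integral_weighted (h : {nnsfun T' >-> R}) (g : T -> R) :
  measurable_fun setT g -> (forall x, 0 <= g x)%R ->
  \int[mu]_x (h (X x) * g x)%:E =
  \sum_(k \in range h) k%:E * \int[mu]_x (\1_(h @^-1` [set k]) (X x) * g x)%:E.
Proof.
move=> mg g0.
have mi k : measurable_fun setT
    (fun x => \1_(h @^-1` [set k]) (X x) * g x : R)%R.
  by apply: measurable_funM => //; apply: measurableT_comp.
transitivity (\int[mu]_x \sum_(k \in range h)
    (k%:E * (\1_(h @^-1` [set k]) (X x) * g x)%:E)).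
  apply: eq_integral => x _.
  rewrite {1}(fimfunE h (X x)) EFinM -fsumEFin// ge0_mule_fsuml.
    by apply: eq_fsbigr => k _; rewrite !EFinM muleA.
  by move=> k; exact: nnfun_muleindic_ge0.
have pos k x : 0 <= k%:E * (\1_(h @^-1` [set k]) (X x) * g x)%:E.
  by rewrite EFinM muleA mule_ge0 ?lee_fin//; exact: nnfun_muleindic_ge0.
rewrite ge0_integral_fsum//; last first.
  by move=> k; apply: measurable_funeM; exact/measurable_EFinP.
apply: eq_fsbigr => k; rewrite inE => -[y _ hy].
rewrite ge0_integralZl//.
- exact/measurable_EFinP.
- by move=> x _; rewrite lee_fin mulr_ge0.
- by rewrite -hy lee_fin.
Qed.

(** Monotone convergence: the simple approximations of [f] increase to [f], and the nonnegative
    weight preserves this. *)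
Lemma integral_weighted_limn (f : T' -> R)
    (mf : measurable_fun setT (EFin \o f)) (g : T -> R) :
  (forall y, 0 <= f y)%R -> measurable_fun setT g -> (forall x, 0 <= g x)%R ->
  \int[mu]_x (nnsfun_approx measurableT mf n (X x) * g x)%:E @[n --> \oo] -->
  \int[mu]_x (f (X x) * g x)%:E.
Proof.
move=> f0 mg g0; set h := nnsfun_approx _ _.
have lim x : (h n (X x) * g x)%:E @[n --> \oo] --> (f (X x) * g x)%:E.
  under eq_fun do rewrite EFinM.
  rewrite EFinM; apply: cvgeZr => //.
  by apply: cvg_nnsfun_approx => // y _; rewrite lee_fin.
rewrite (_ : (fun x => (f (X x) * g x)%:E) =
             (fun x => limn (fun n => (h n (X x) * g x)%:E))); last first.
  by apply/funext => x; apply/esym/cvg_lim.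
apply: cvg_monotone_convergence => //.
- move=> n; apply/measurable_EFinP/measurable_funM => //.
  exact: measurableT_comp.
- by move=> n x _; rewrite lee_fin mulr_ge0.
- move=> x _ m n mn; rewrite lee_fin ler_wpM2r//.
  exact/lefP/nd_nnsfun_approx.
Qed.

(** Used to exchange the weight [g1] for [g2] after a test on indicators only: equality passes to
    simple functions by linearity, then to [f] by uniqueness of limits. *)
Lemma eq_integral_weighted (f : T' -> R) (g1 g2 : T -> R) :
  measurable_fun setT f -> (forall y, 0 <= f y)%R ->
  measurable_fun setT g1 -> (forall x, 0 <= g1 x)%R ->
  measurable_fun setT g2 -> (forall x, 0 <= g2 x)%R ->
  (forall B, measurable B ->
    \int[mu]_x (\1_B (X x) * g1 x)%:E = \int[mu]_x (\1_B (X x) * g2 x)%:E) ->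
  \int[mu]_x (f (X x) * g1 x)%:E = \int[mu]_x (f (X x) * g2 x)%:E.
Proof.
move=> mf f0 mg1 g10 mg2 g20 eq_indic.
have mf' : measurable_fun setT (EFin \o f) by exact/measurable_EFinP.
have eq_approx n :
    \int[mu]_x (nnsfun_approx measurableT mf' n (X x) * g2 x)%:E =
    \int[mu]_x (nnsfun_approx measurableT mf' n (X x) * g1 x)%:E.
  rewrite !nnsfun_integral_weighted//.
  by apply: eq_fsbigr => k _; rewrite eq_indic.
have lim2 := integral_weighted_limn mf' f0 mg2 g20.
have lim1 := integral_weighted_limn mf' f0 mg1 g10.
rewrite (funext eq_approx) in lim2.
exact: cvg_unique lim1 lim2.
Qed.
End WeightedIntegral.

(* Enlarges the class of admissible coordinates from A to B, one coordinate at a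
   time. *)
Lemma family_ind (F : Type) (A B : nat -> F -> Prop) (Q : (nat -> F) -> Prop) :
  (forall i f, A i f -> B i f) ->
  (forall f, (forall i, A i (f i)) -> Q f) ->
  (forall i f, (forall j, B j (f j)) ->
    (forall g, A i g -> Q (fun j => if j == i then g else f j)) -> Q f) ->
  forall (s : seq nat) f, (forall i, B i (f i)) ->
    (forall i, i \notin s -> A i (f i)) -> Q f.
Proof.
move=> AB Q0 QS; elim=> [|i s IHs] f Bf Af; first by apply: Q0 => i; exact: Af.
apply: (QS i) => // g Ag; apply: IHs => j.
  by case: eqP => // ->; exact: AB.
by move=> js; case: eqP => [->//|/eqP ji]; apply: Af; rewrite inE negb_or ji.
Qed.

Lemma measurable_prodr (disp : measure_display) (T : measurableType disp)
    (R : realType) (I : Type) (r : seq I) (p : pred I) (f : I -> T -> R) :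
  (forall i, measurable_fun setT (f i)) ->
  measurable_fun setT (fun x => \prod_(i <- r | p i) f i x).
Proof.
move=> mf; elim: r => [|i r IHr].
  by under eq_fun do rewrite big_nil; exact: measurable_cst.
under eq_fun do rewrite big_cons.
by case: (p i) => //; exact: measurable_funM.
Qed.

Section IndependentProducts.
Context (disp disp' : measure_display) (T : measurableType disp)
  (T' : measurableType disp') (R : realType) (P : probability T R).
Variable X : nat -> {RV P >-> T'}.
Hypothesis indepX : mutually_independent X.

Lemma prod_indic (J : {fset nat}) (B : nat -> set T') w :
  \prod_(j <- J) \1_(B j) (X j w) =
  \1_(\bigcap_(j in [set` J]) (X j @^-1` B j)) w :> R.
Proof.
set D := \bigcap_(j in _) _.
rewrite indicE; have [Dw|nDw] := pselect (D w).
  rewrite mem_set// big_seq big1// => j jJ.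
  by rewrite indicE mem_set//; exact: Dw.
rewrite memNset//.
have [j jJ nBj] : exists2 j, j \in J & ~ B j (X j w).
  apply: contrapT => nex; apply: nDw => j /= jJ; apply: contrapT => nB.
  by apply: nex; exists j.
by rewrite (big_rem j)//= indicE memNset// mul0r.
Qed.

(** For indicators this is the definition of independence. [family_ind] then replaces the indicators
    by general nonnegative functions, one coordinate at a time. *)
Lemma integral_prod_ge0 (J : {fset nat}) (f : nat -> T' -> R) :
  (forall i, measurable_fun setT (f i)) -> (forall i y, 0 <= f i y) ->
  (forall i, P.-integrable setT (EFin \o (f i \o X i))) ->
  (\int[P]_w (\prod_(j <- J) f j (X j w))%:E =
   (\prod_(j <- J) \int[P]_w f j (X j w))%:E)%E.
Proof.
move=> mf f0 intf.
pose A := fun (_ : nat) (g : T' -> R) => exists2 B, measurable B & g = \1_B.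
pose B := fun (i : nat) (g : T' -> R) =>
  [/\ measurable_fun setT g, forall y, 0 <= g y
  & P.-integrable setT (EFin \o (g \o X i))].
have AB i g : A i g -> B i g.
  move=> [D mD ->]; split => //.
  exact: (@integrable_indic _ _ _ P _ (measurable_funPTI (X i) mD)).
pose Q f := (\int[P]_w (\prod_(j <- J) f j (X j w))%:E =
   (\prod_(j <- J) \int[P]_w f j (X j w))%:E)%E.
(* Only finitely many coordinates can be enlarged, so those outside [J], which neither side sees,
   are made indicators from the start. *)
pose f' i := if i \in J then f i else \1_setT.
suff : Q f'.
  have Ef (E : nat -> (T' -> R) -> R) :
      \prod_(j <- J) E j (f' j) = \prod_(j <- J) E j (f j).
    by rewrite big_seq [RHS]big_seq; apply: eq_bigr => j jJ; rewrite /f' jJ.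
  rewrite /Q (Ef (fun j g => \int[P]_w g (X j w))) => <-.
  by apply: eq_integral => w _; rewrite (Ef (fun j g => g (X j w))).
apply: (@family_ind _ A B Q AB _ _ J) => [||i|i]; last 2 first.
- by rewrite /f'; case: ifP => // _; apply: AB; exists setT.
- by move=> /negbTE iJ; rewrite /f' iJ; exists setT.
(* Base case: a product of indicators is the indicator of an intersection, whose probability factors
   by independence. *)
- move=> {f mf f0 intf f'} f Af.
  have [D DE] : exists D : nat -> set T',
      forall i, measurable (D i) /\ f i = \1_(D i).
    have /choice[D DE] : forall i, exists D, measurable D /\ f i = \1_D.
      by move=> i; have [D] := Af i; exists D.
    by exists D.
  have mXD j : measurable (X j @^-1` D j).
    exact: measurable_funPTI (DE j).1.
  have intE j : \int[P]_w f j (X j w) = fine (P (X j @^-1` D j)).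
    rewrite (DE j).2 /Rintegral; congr fine.
    rewrite (_ : (fun w => (\1_(D j) (X j w))%:E) =
                 EFin \o \1_(X j @^-1` D j))//.
    by rewrite integral_indic// setIT.
  rewrite /Q (eq_bigr _ (fun j _ => intE j)).
  rewrite (eq_integral (fun w =>
      (\1_(\bigcap_(j in [set` J]) (X j @^-1` D j)) w)%:E)); last first.
    move=> w _; rewrite -prod_indic; congr _%:E.
    by apply: eq_bigr => j _; rewrite (DE j).2.
  rewrite integral_indic ?setIT//; last first.
    by apply: fin_bigcap_measurable => //; exact: finite_fset.
  rewrite [LHS]indepX; last by move=> j _; exact: (DE j).1.
  rewrite -prodEFin; apply: eq_bigr => j _.
  by rewrite fineK// fin_num_measure.
- move=> i g Bg Qg; have [iJ|iJ] := boolP (i \in J); last first.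
    have /Qg : A i \1_setT by exists setT.
    have prodE (E : nat -> (T' -> R) -> R) :
        \prod_(j <- J) E j (if j == i then \1_setT else g j) =
        \prod_(j <- J) E j (g j).
      rewrite big_seq [RHS]big_seq; apply: eq_bigr => j jJ.
      by case: eqP jJ iJ => // -> ->.
    rewrite /Q (prodE (fun j h => \int[P]_w h (X j w))) => <-.
    by apply: eq_integral => w _; rewrite (prodE (fun j h => h (X j w))).
  (* With coordinate [i] isolated, the claim says that [h (X i w)] has the same integral against the
     weight [G] as against the constant [c]. It is known for indicators [h], hence holds for
     [g i]. *)
  pose G w := \prod_(j <- J | j != i) g j (X j w).
  pose c := \prod_(j <- J | j != i) \int[P]_w g j (X j w).
  have prodE (E : nat -> (T' -> R) -> R) h :
      \prod_(j <- J) E j (if j == i then h else g j) =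
      E i h * \prod_(j <- J | j != i) E j (g j).
    rewrite (bigD1_seq i)/= ?fset_uniq// eqxx; congr (_ * _).
    by apply: eq_bigr => j /negbTE ->.
  have QE h : Q (fun j => if j == i then h else g j) =
     (\int[P]_w (h (X i w) * G w)%:E = (\int[P]_w h (X i w) * c)%R%:E)%E.
    rewrite /Q (prodE (fun j h => \int[P]_w h (X j w))); congr (_ = _).
    by apply: eq_integral => w _; rewrite (prodE (fun j h => h (X j w))).
  have gE : (fun j => if j == i then g i else g j) = g.
    by apply/funext => j; case: eqP => // ->.
  have mg j : measurable_fun setT (fun w => g j (X j w)).
    by have [mg _ _] := Bg j; exact: measurableT_comp.
  have [mgi gi0 intgi] := Bg i.
  have G0 w : 0 <= G w by apply: prodr_ge0 => j _; have [_ ->] := Bg j.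
  have c0 : 0 <= c.
    apply: prodr_ge0 => j _; apply: Rintegral_ge0 => w _.
    by have [_ ->] := Bg j.
  rewrite -gE QE.
  have EM h : P.-integrable setT (EFin \o (h \o X i)) ->
      (\int[P]_w (h (X i w) * c)%:E = (\int[P]_w h (X i w) * c)%R%:E)%E.
    move=> inth; under eq_integral do rewrite EFinM.
    rewrite integralZr//= EFinM /Rintegral fineK//.
    exact: integrable_fin_num.
  rewrite (eq_integral_weighted _ mgi gi0 _ G0 (measurable_cst c) (fun=> c0))//.
  - exact: EM.
  - exact: measurable_prodr.
  - move=> D mD; have /Qg : A i \1_D by exists D.
    rewrite QE => ->; rewrite -EM//.
    by have [] : B i \1_D by apply: AB; exists D.
Qed.
End IndependentProducts.

(** * Complex-valued random variables *)

Definition cmeasurable (disp : measure_display) (T : measurableType disp)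
    (R : realType) (f : T -> R[i]) : Prop :=
  measurable_fun setT (fun x => complex.Re (f x)) /\
  measurable_fun setT (fun x => complex.Im (f x)).

Definition cintegrable (disp : measure_display) (T : measurableType disp)
    (R : realType) (mu : {measure set T -> \bar R}) (f : T -> R[i]) : Prop :=
  mu.-integrable setT (fun x => (complex.Re (f x))%:E) /\
  mu.-integrable setT (fun x => (complex.Im (f x))%:E).

Definition cintegral (disp : measure_display) (T : measurableType disp)
    (R : realType) (mu : {measure set T -> \bar R}) (f : T -> R[i]) : R[i] :=
  (\int[mu]_x complex.Re (f x)) +i* (\int[mu]_x complex.Im (f x)).

Lemma complex_ReM (R : rcfType) (x y : R[i]) :
  complex.Re (x * y) =
  complex.Re x * complex.Re y - complex.Im x * complex.Im y.
Proof. by case: x y => a b [c e]. Qed.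

Lemma complex_ImM (R : rcfType) (x y : R[i]) :
  complex.Im (x * y) =
  complex.Re x * complex.Im y + complex.Im x * complex.Re y.
Proof. by case: x y => a b [c e] /=. Qed.

Lemma complex_ReJ (R : rcfType) (x : R[i]) :
  complex.Re (Num.conj x) = complex.Re x.
Proof. by case: x. Qed.

Lemma complex_ImJ (R : rcfType) (x : R[i]) :
  complex.Im (Num.conj x) = - complex.Im x.
Proof. by case: x. Qed.

Section ComplexMeasurability.
Context (disp : measure_display) (T : measurableType disp) (R : realType).
Implicit Types f g : T -> R[i].

Lemma cmeasurable_cst (z : R[i]) : cmeasurable (fun _ : T => z).
Proof. by split; exact: measurable_cst. Qed.

Lemma cmeasurableD f g :
  cmeasurable f -> cmeasurable g -> cmeasurable (fun x => f x + g x).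
Proof.
move=> [mf1 mf2] [mg1 mg2]; split.
  under eq_fun do rewrite raddfD/=.
  exact: measurable_funD.
under eq_fun do rewrite raddfD/=.
exact: measurable_funD.
Qed.

Lemma cmeasurableM f g :
  cmeasurable f -> cmeasurable g -> cmeasurable (fun x => f x * g x).
Proof.
move=> [mf1 mf2] [mg1 mg2]; split.
  under eq_fun do rewrite complex_ReM.
  by apply: measurable_funB; exact: measurable_funM.
under eq_fun do rewrite complex_ImM.
by apply: measurable_funD; exact: measurable_funM.
Qed.

Lemma cmeasurable_conj f :
  cmeasurable f -> cmeasurable (fun x => Num.conj (f x)).
Proof.
move=> [mf1 mf2]; split.
  by under eq_fun do rewrite complex_ReJ.
by under eq_fun do rewrite complex_ImJ; exact: measurable_funN.
Qed.

Lemma cmeasurable_sum (I : Type) (r : seq I) (p : pred I) (f : I -> T -> R[i]) :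
  (forall i, cmeasurable (f i)) ->
  cmeasurable (fun x => \sum_(i <- r | p i) f i x).
Proof.
move=> mf; elim: r => [|i r IHr].
  by under eq_fun do rewrite big_nil; exact: cmeasurable_cst.
under eq_fun do rewrite big_cons.
by case: (p i) => //; exact: cmeasurableD.
Qed.

Lemma cmeasurable_prod (I : Type) (r : seq I) (p : pred I)
    (f : I -> T -> R[i]) :
  (forall i, cmeasurable (f i)) ->
  cmeasurable (fun x => \prod_(i <- r | p i) f i x).
Proof.
move=> mf; elim: r => [|i r IHr].
  by under eq_fun do rewrite big_nil; exact: cmeasurable_cst.
under eq_fun do rewrite big_cons.
by case: (p i) => //; exact: cmeasurableM.
Qed.

End ComplexMeasurability.

Section ComplexIntegral.
Context (disp : measure_display) (T : measurableType disp) (R : realType)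
  (mu : {measure set T -> \bar R}).
Implicit Types f g : T -> R[i].

Lemma cintegralD f g : cintegrable mu f -> cintegrable mu g ->
  cintegrable mu (fun x => f x + g x) /\
  cintegral mu (fun x => f x + g x) = cintegral mu f + cintegral mu g.
Proof.
move=> [f1 f2] [g1 g2]; split.
  split; under eq_fun do rewrite raddfD/=.
    by under eq_fun do rewrite EFinD; exact: integrableD.
  by under eq_fun do rewrite EFinD; exact: integrableD.
rewrite /cintegral; congr (_ +i* _).
  by under eq_Rintegral do rewrite raddfD/=; rewrite RintegralD.
by under eq_Rintegral do rewrite raddfD/=; rewrite RintegralD.
Qed.

Lemma cintegralZ (z : R[i]) f : cintegrable mu f ->
  cintegrable mu (fun x => z * f x) /\
  cintegral mu (fun x => z * f x) = z * cintegral mu f.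
Proof.
move=> [f1 f2].
have iZ (a : R) (h : T -> R) : mu.-integrable setT (fun x => (h x)%:E) ->
    mu.-integrable setT (fun x => (a * h x)%:E).
  by move=> ih; under eq_fun do rewrite EFinM; exact: integrableZl.
split.
  split.
    under eq_fun do rewrite complex_ReM EFinB.
    by apply: integrableB => //; exact: iZ.
  under eq_fun do rewrite complex_ImM EFinD.
  by apply: integrableD => //; exact: iZ.
case: z => a b; rewrite /cintegral; congr (_ +i* _).
  under eq_Rintegral do rewrite complex_ReM.
  rewrite RintegralB//; [|exact: iZ..].
  by rewrite !RintegralZl.
under eq_Rintegral do rewrite complex_ImM.
rewrite RintegralD//; [|exact: iZ..].
by rewrite !RintegralZl.
Qed.

Lemma cintegral0 : cintegrable mu (fun=> 0) /\ cintegral mu (fun=> 0) = 0.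
Proof.
split; first by split; exact: integrable0.
by rewrite /cintegral /Rintegral !integral0.
Qed.

Lemma cintegral_sum (I : Type) (r : seq I) (z : I -> R[i])
    (f : I -> T -> R[i]) :
  (forall i, cintegrable mu (f i)) ->
  cintegrable mu (fun x => \sum_(i <- r) z i * f i x) /\
  cintegral mu (fun x => \sum_(i <- r) z i * f i x) =
  \sum_(i <- r) z i * cintegral mu (f i).
Proof.
move=> intf; elim: r => [|i r [IH1 IH2]].
  by under eq_fun do rewrite big_nil; rewrite big_nil; exact: cintegral0.
under eq_fun do rewrite big_cons.
have [iZ eZ] := cintegralZ (z i) (intf i).
by have [iD ->] := cintegralD iZ IH1; rewrite big_cons eZ IH2.
Qed.

Lemma le_cintegrable f (g : T -> R) : cmeasurable f ->
  (forall x, `|f x| <= (g x)%:C) ->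
  mu.-integrable setT (EFin \o g) -> cintegrable mu f.
Proof.
move=> [mf1 mf2] fg intg; split.
  apply: le_integrable intg => //; first exact/measurable_EFinP.
  move=> x _ /=; rewrite lee_fin -lecR.
  apply: le_trans (normc_ge_Re _) _.
  by rewrite (le_trans (fg x))// lecR ler_norm.
apply: le_integrable intg => //; first exact/measurable_EFinP.
move=> x _ /=; rewrite lee_fin -lecR.
(* Multiplication by ['i] keeps the modulus and turns imaginary parts into real parts, so the bound
   of a real part by the modulus serves again. *)
have -> : complex.Im (f x) = - complex.Re (f x * 'i) by rewrite ReiNIm opprK.
rewrite normrN; apply: le_trans (normc_ge_Re _) _.
rewrite normrM (_ : `|'i| = 1) ?mulr1; last first.
  by rewrite normc_def/= expr0n add0r expr1n sqrtr1.
by rewrite (le_trans (fg x))// lecR ler_norm.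
Qed.

End ComplexIntegral.

Section ComplexIndependentProducts.
Context (disp disp' : measure_display) (T : measurableType disp)
  (T' : measurableType disp') (R : realType) (P : probability T R).
Variable X : nat -> {RV P >-> T'}.
Hypothesis indepX : mutually_independent X.

Lemma cintegral_real_complex (h : T -> R) :
  P.-integrable setT (EFin \o h) ->
  cintegrable P (fun x => (h x)%:C) /\
  cintegral P (fun x => (h x)%:C) = (\int[P]_x h x)%:C.
Proof.
move=> ih; split; first by split => //=; exact: integrable0.
by rewrite /cintegral/= /Rintegral integral0.
Qed.

(** Both sides are linear in each factor, and a complex function is a combination of four
    nonnegative ones; [family_ind] thus reduces the claim to [integral_prod_ge0]. *)
Lemma cintegral_prod (J : {fset nat}) (f : nat -> T' -> R[i]) :
  (forall i, cmeasurable (f i)) ->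
  (forall i, cintegrable P (fun w => f i (X i w))) ->
  cintegrable P (fun w => \prod_(j <- J) f j (X j w)) /\
  cintegral P (fun w => \prod_(j <- J) f j (X j w)) =
  \prod_(j <- J) cintegral P (fun w => f j (X j w)).
Proof.
move=> mf intf.
pose nneg i (h : T' -> R) := [/\ measurable_fun setT h, forall y, 0 <= h y
  & P.-integrable setT (EFin \o (h \o X i))].
pose A i (g : T' -> R[i]) := exists2 h, nneg i h & g = (fun y => (h y)%:C).
pose B i (g : T' -> R[i]) :=
  cmeasurable g /\ cintegrable P (fun w => g (X i w)).
have AB i g : A i g -> B i g.
  move=> [h [mh h0 ih] ->]; split; last by have [] := cintegral_real_complex ih.
  by split => //=; exact: measurable_cst.
pose Q (f : nat -> T' -> R[i]) :=
  cintegrable P (fun w => \prod_(j <- J) f j (X j w)) /\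
  cintegral P (fun w => \prod_(j <- J) f j (X j w)) =
  \prod_(j <- J) cintegral P (fun w => f j (X j w)).
have nneg1 i : nneg i (cst 1).
  by split => //; exact: (finite_measure_integrable_cst P 1 measurableT).
have A1 i : A i (cst 1) by exists (cst 1).
have QE f1 f2 : (forall j, j \in J -> f1 j = f2 j) -> Q f1 -> Q f2.
  move=> f12; have E (F : nat -> (T' -> R[i]) -> R[i]) :
      \prod_(j <- J) F j (f1 j) = \prod_(j <- J) F j (f2 j).
    by rewrite big_seq [RHS]big_seq; apply: eq_bigr => j /f12 ->.
  rewrite /Q (E (fun j h => cintegral P (fun w => h (X j w)))).
  by under eq_fun do rewrite (E (fun j h => h (X j _))).
pose f' i := if i \in J then f i else cst 1.
suff : Q f' by apply: QE => j jJ; rewrite /f' jJ.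
apply: (@family_ind _ A B Q AB _ _ J) => [||i|i]; last 2 first.
- by rewrite /f'; case: ifP => // _; apply: AB.
- by move=> /negbTE iJ; rewrite /f' iJ.
- move=> {f mf intf f'} f Af.
  have /choice[h hP] :
      forall i, exists h, nneg i h /\ f i = (fun y => (h y)%:C).
    by move=> i; have [h] := Af i; exists h.
  have fE j : f j = (fun y => (h j y)%:C) := (hP j).2.
  have mh j : measurable_fun setT (h j) by have [[]] := hP j.
  have h0 j y : 0 <= h j y by have [[]] := hP j.
  have ih j : P.-integrable setT (EFin \o (h j \o X j)) by have [[]] := hP j.
  have prodE w : \prod_(j <- J) f j (X j w) = (\prod_(j <- J) h j (X j w))%:C.
    by rewrite rmorph_prod; apply: eq_bigr => j _; rewrite fE.
  have intE := integral_prod_ge0 indepX J mh h0 ih.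
  have iprod : P.-integrable setT
      (EFin \o (fun w => \prod_(j <- J) h j (X j w))).
    apply/integrableP; split.
      apply/measurable_EFinP/measurable_prodr => j.
      exact: measurableT_comp.
    (* The product formula itself shows integrability: it equates the integral of the nonnegative
       product with a real number. *)
    under eq_integral do rewrite /= ger0_norm ?prodr_ge0//.
    by rewrite intE ltry.
  have [iC EC] := cintegral_real_complex iprod.
  rewrite /Q (funext prodE); split => //.
  rewrite EC /Rintegral intE/= rmorph_prod; apply: eq_bigr => j _.
  by rewrite fE (cintegral_real_complex (ih j)).2.
- move=> i g Bg Qg; have [iJ|iJ] := boolP (i \in J); last first.
    by apply: QE (Qg _ (A1 i)) => j jJ; case: eqP jJ iJ => // -> ->.
  pose G w := \prod_(j <- J | j != i) g j (X j w).
  pose c := \prod_(j <- J | j != i) cintegral P (fun w => g j (X j w)).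
  have prodE (E : nat -> (T' -> R[i]) -> R[i]) h :
      \prod_(j <- J) E j (if j == i then h else g j) =
      E i h * \prod_(j <- J | j != i) E j (g j).
    rewrite (bigD1_seq i)/= ?fset_uniq// eqxx; congr (_ * _).
    by apply: eq_bigr => j /negbTE ->.
  have {}QE h : Q (fun j => if j == i then h else g j) <->
     cintegrable P (fun w => h (X i w) * G w) /\
     cintegral P (fun w => h (X i w) * G w) =
     cintegral P (fun w => h (X i w)) * c.
    rewrite /Q (prodE (fun j h => cintegral P (fun w => h (X j w)))).
    by under eq_fun do rewrite (prodE (fun j h => h (X j _))).
  have gE : (fun j => if j == i then g i else g j) = g.
    by apply/funext => j; case: eqP => // ->.
  rewrite -gE; apply/QE => {gE}.
  have [[mg1 mg2] [ig1 ig2]] := Bg i.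
  (* The first boolean selects the real or imaginary part, the second its positive or negative part;
     [z] holds the matching coefficients 1, -1, ['i], -['i]. *)
  pose q (a : bool) y := if a then complex.Im (g i y) else complex.Re (g i y).
  pose h (p : bool * bool) := if p.2 then (q p.1)^\- else (q p.1)^\+.
  pose z (p : bool * bool) : R[i] := (-1) ^+ p.2 * (if p.1 then 'i else 1).
  have nneg_h p : nneg i (h p).
    have mq a : measurable_fun setT (q a) by case: a.
    have iq a : P.-integrable setT (EFin \o (q a \o X i)) by case: a.
    split; rewrite /h; case: p => a b /=.
    - by case: b; [exact: measurable_funrneg|exact: measurable_funrpos].
    - by case: b.
    - by case: b; [exact: (integrable_funrneg measurableT (iq a))
                  |exact: (integrable_funrpos measurableT (iq a))].
  have Qh p := (QE _).1 (Qg _ (ex_intro2 _ _ _ (nneg_h p) erefl)).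
  pose r := [:: (false, false); (false, true); (true, false); (true, true)].
  have gE y : g i y = \sum_(p <- r) z p * (h p y)%:C.
    have posBneg (e : T' -> R) : e y = e^\+ y - e^\- y.
      by rewrite -[in LHS](funrposBneg e).
    rewrite !big_cons big_nil /z /h /= expr0 expr1 !mulNr !mul1r addr0.
    rewrite addrA -rmorphB -mulrBr -rmorphB/= -!posBneg /q /=.
    exact: complexE.
  have [i1 e1] := cintegral_sum r z (fun p => (Qh p).1).
  have inth p : P.-integrable setT (EFin \o (h p \o X i)).
    by have [] := nneg_h p.
  have [i2 e2] :=
    cintegral_sum r z (fun p => (cintegral_real_complex (inth p)).1).
  have -> : (fun w => g i (X i w) * G w) =
      (fun w => \sum_(p <- r) z p * ((h p (X i w))%:C * G w)).
    apply/funext => w; rewrite gE mulr_suml.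
    by apply: eq_bigr => p _; rewrite mulrA.
  have -> : (fun w => g i (X i w)) =
      (fun w => \sum_(p <- r) z p * (h p (X i w))%:C) by apply/funext => w.
  split => //; rewrite e1 e2 mulr_suml; apply: eq_bigr => p _.
  by rewrite (Qh p).2 mulrA.
Qed.
End ComplexIndependentProducts.

(** * Random matrices *)

Section BorelMatrices.
Variable R : realType.

Lemma continuous_Re : continuous (fun z : R[i] => complex.Re z).
Proof.
move=> x; have filter_x : Filter (nbhs x) by exact: nbhs_filter.
apply/cvgrPdist_lt => e e0.
exists e%:C => [|y xy]; first by rewrite /= ltcR.
by rewrite -raddfB -ltcR; apply: le_lt_trans (normc_ge_Re _) _.
Qed.

Lemma continuous_Im : continuous (fun z : R[i] => complex.Im z).
Proof.
move=> x; have filter_x : Filter (nbhs x) by exact: nbhs_filter.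
apply/cvgrPdist_lt => e e0.
exists e%:C => [|y xy]; first by rewrite /= ltcR.
have -> : complex.Im x - complex.Im y = - complex.Re ((x - y) * 'i).
  by rewrite ReiNIm opprK raddfB.
rewrite normrN -ltcR; apply: le_lt_trans (normc_ge_Re _) _.
rewrite normrM (_ : `|'i| = 1) ?mulr1//.
by rewrite normc_def/= expr0n add0r expr1n sqrtr1.
Qed.

(** Open intervals generate the Borel sets of the line, and their preimages are open. *)
Lemma continuous_borel_measurable (d : nat) (f : 'M[R[i]]_d -> R) :
  continuous f -> measurable_fun setT (f : borel_mx R d -> R).
Proof.
move=> /continuousP cf; apply: (measurability _ (RGenOpens.measurableE R)).
move=> _ [_ [a [b ->] <-]]; rewrite setTI.
by apply: sub_sigma_algebra; apply: cf; exact: interval_open.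
Qed.

Lemma cmeasurable_coord (d : nat) (i j : 'I_d) :
  cmeasurable (fun A : borel_mx R d => (A : 'M[R[i]]_d) i j).
Proof.
split; apply: continuous_borel_measurable => A.
  apply: (@continuous_comp _ _ _ (fun A : 'M[R[i]]_d => A i j)).
    exact: coord_continuous.
  exact: continuous_Re.
apply: (@continuous_comp _ _ _ (fun A : 'M[R[i]]_d => A i j)).
  exact: coord_continuous.
exact: continuous_Im.
Qed.

End BorelMatrices.

Section HilbertSchmidt.
Variables (R : realType) (d : nat).
Implicit Types A : 'M[R[i]]_d.

Lemma mxtrace_adjoint A :
  \tr (A ^t* *m A) = \sum_(p : 'I_d * 'I_d) `|A p.1 p.2| ^+ 2.
Proof.
rewrite -(pair_bigA _ (fun i j => `|A i j| ^+ 2)) exchange_big/=.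
apply: eq_bigr => i _; rewrite mxE; apply: eq_bigr => j _.
by rewrite !mxE sqr_normc mulrC.
Qed.

Lemma hs_norm_sq A : (hs_norm A ^+ 2)%:C = \tr (A ^t* *m A).
Proof.
have tr0 : 0 <= \tr (A ^t* *m A).
  by rewrite mxtrace_adjoint sumr_ge0// => p _; rewrite exprn_ge0.
have trE : (complex.Re (\tr (A ^t* *m A)))%:C = \tr (A ^t* *m A).
  exact/RRe_real/ger0_real.
by rewrite /hs_norm sqr_sqrtr// -ler0c trE.
Qed.

(** Cyclicity of the trace brings in [A *m A ^t*], the congruence by [A] of the identity, to which
    [trace_exp] applies. *)
Lemma hs_norm_expM A k : (hs_norm A ^+ (2 * k))%:C = (\tr (A *m A ^t*)) ^+ k.
Proof. by rewrite exprM rmorphXn /= hs_norm_sq mxtrace_mulC. Qed.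

Lemma hs_norm_ge0 A : 0 <= hs_norm A.
Proof. exact: sqrtr_ge0. Qed.

Lemma normr_entry_le_hs_norm A i j : `|A i j| <= (hs_norm A)%:C.
Proof.
rewrite -(@ler_pXn2r _ 2)// ?nnegrE ?ler0c ?hs_norm_ge0//.
rewrite -[leRHS]rmorphXn/= hs_norm_sq mxtrace_adjoint (bigD1 (i, j))//= lerDl.
by rewrite sumr_ge0// => p _; rewrite exprn_ge0.
Qed.

Lemma measurable_hs_norm k :
  measurable_fun setT
    (fun A : borel_mx R d => hs_norm (A : 'M[R[i]]_d) ^+ (2 * k)).
Proof.
have mtr :
    cmeasurable (fun A : borel_mx R d => \tr ((A : 'M[R[i]]_d) ^t* *m A)).
  apply: cmeasurable_sum => i; under eq_fun do rewrite mxE.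
  apply: cmeasurable_sum => j; under eq_fun do rewrite !mxE.
  by apply: cmeasurableM; [apply: cmeasurable_conj|]; exact: cmeasurable_coord.
have -> : (fun A : borel_mx R d => hs_norm (A : 'M[R[i]]_d) ^+ (2 * k)) =
   (fun A => complex.Re (\tr ((A : 'M[R[i]]_d) ^t* *m A)) ^+ k).
  by apply/funext => A; rewrite exprM -hs_norm_sq.
by apply: measurable_funX; exact: mtr.1.
Qed.

Variables (k m : nat) (e : 'I_d * 'I_d -> 'I_m.+1) (r : 'I_m.+1 -> 'I_d * 'I_d).

Lemma cmeasurable_transfer_mx a b :
  cmeasurable (fun A : borel_mx R d => transfer_mx k e r (A : 'M[R[i]]_d) a b).
Proof.
under eq_fun do rewrite mxE.
apply: cmeasurable_sum => t; apply: cmeasurable_prod => i.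
by apply: cmeasurableM; [|apply: cmeasurable_conj]; exact: cmeasurable_coord.
Qed.

(** Each term is a product of [2 * k] entries of [A] or their conjugates, each at most the norm.
    This crude bound reduces integrability of the transfer matrix to the moment of order [2 * k]. *)
Lemma normr_transfer_mx_le A a b :
  `|transfer_mx k e r A a b| <=
  ((#|{ffun 'I_k -> 'I_d * 'I_d}|)%:R * hs_norm A ^+ (2 * k))%:C.
Proof.
rewrite mxE; apply: le_trans (ler_norm_sum _ _ _) _.
have -> : ((#|{ffun 'I_k -> 'I_d * 'I_d}|)%:R * hs_norm A ^+ (2 * k))%:C =
    \sum_(t : {ffun 'I_k -> 'I_d * 'I_d}) \prod_(i < k) (hs_norm A ^+ 2)%:C.
  by rewrite prodr_const sumr_const card_ord mulr_natl rmorphMn exprM rmorphXn.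
rewrite [leRHS](bigID (fun t => multi_class e t == b))/=.
apply: ler_wpDr.
  apply: sumr_ge0 => t _; apply: prodr_ge0 => i _.
  by rewrite ler0c exprn_ge0// hs_norm_ge0.
apply: ler_sum => t _; rewrite normr_prod; apply: ler_prod => i _.
rewrite normr_ge0/= normrM norm_conjC expr2 rmorphM.
by apply: ler_pM => //; exact: normr_entry_le_hs_norm.
Qed.

End HilbertSchmidt.

(** * Identical distribution and expected products of random matrices *)

Section IdenticallyDistributed.
Context (disp disp' : measure_display) (T : measurableType disp)
  (T' : measurableType disp') (R : realType) (P : probability T R).
Variable X : nat -> {RV P >-> T'}.
Hypothesis idX : identically_distributed X.

(** Integrability is finiteness of the integral of the absolute value of [f] against the law, which
    is common to all indices. *)
Lemma integrable_id (f : T' -> R) i j : measurable_fun setT f ->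
  P.-integrable setT (fun w => (f (X i w))%:E) ->
  P.-integrable setT (fun w => (f (X j w))%:E).
Proof.
move=> mf /integrableP[_ intf]; apply/integrableP; split.
  by apply/measurable_EFinP; exact: measurableT_comp.
pose g y := (`|f y|%:E); have mg : measurable_fun setT g.
  by apply/measurable_EFinP; exact: measurableT_comp.
have g0 y : (0 <= g y)%E by rewrite lee_fin.
move: intf.
rewrite -[X in (X < _)%E -> _](ge0_integral_distribution (X i) mg g0).
rewrite -[X in _ -> (X < _)%E](ge0_integral_distribution (X j) mg g0).
by rewrite (eq_measure_integral (distribution P (X j)))// => B mB _; exact: idX.
Qed.

Lemma Rintegral_id (f : T' -> R) i j : measurable_fun setT f ->
  P.-integrable setT (fun w => (f (X i w))%:E) ->
  \int[P]_w f (X i w) = \int[P]_w f (X j w).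
Proof.
move=> mf intf; have intfj := integrable_id j mf intf.
have mf' : measurable_fun setT (EFin \o f) by exact/measurable_EFinP.
rewrite /Rintegral -(integral_distribution mf' intf).
rewrite -(integral_distribution mf' intfj); congr fine.
by apply: eq_measure_integral => B mB _; exact: idX.
Qed.

Lemma cintegral_id (f : T' -> R[i]) i j : cmeasurable f ->
  cintegrable P (fun w => f (X i w)) ->
  cintegrable P (fun w => f (X j w)) /\
  cintegral P (fun w => f (X j w)) = cintegral P (fun w => f (X i w)).
Proof.
move=> [mf1 mf2] [if1 if2]; split.
  by split; [exact: (integrable_id j mf1 if1)|exact: (integrable_id j mf2 if2)].
by rewrite /cintegral (Rintegral_id j mf1 if1) (Rintegral_id j mf2 if2).
Qed.

End IdenticallyDistributed.

Section RandomMatrixProducts.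
Context (disp disp' : measure_display) (T : measurableType disp)
  (T' : measurableType disp') (R : realType) (P : probability T R).
Variable X : nat -> {RV P >-> T'}.
Hypothesis iidX : iid X.
Variables (l : nat) (W : T' -> 'M[R[i]]_l).
Hypothesis mW : forall a b, cmeasurable (fun y => W y a b).
Hypothesis intW : forall a b, cintegrable P (fun w => W (X 0%N w) a b).

Definition mean_mx : 'M[R[i]]_l :=
  \matrix_(a, b) cintegral P (fun w => W (X 0%N w) a b).

Lemma cintegral_nat_prod (N : nat) (g : nat -> T' -> R[i]) :
  (forall i, cmeasurable (g i)) ->
  (forall i, cintegrable P (fun w => g i (X i w))) ->
  cintegrable P (fun w => \prod_(1 <= i < N) g i (X i w)) /\
  cintegral P (fun w => \prod_(1 <= i < N) g i (X i w)) =
  \prod_(1 <= i < N) cintegral P (fun w => g i (X i w)).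
Proof.
move=> mg ig; pose J := [fset i in index_iota 1 N]%fset.
have JE : perm_eq (index_iota 1 N) J.
  by apply: uniq_perm => [||i]; rewrite ?iota_uniq ?fset_uniq// inE.
rewrite (perm_big _ JE)/=.
under eq_fun do rewrite (perm_big _ JE)/=.
exact: (cintegral_prod iidX.1).
Qed.

(* The arbitrary factors g make the induction on n work: the entries of
   W (X n.+1) become one of them when n.+1 decreases to n. *)
Lemma cintegral_mxprod_tail (N n : nat) (a b : 'I_l) (g : nat -> T' -> R[i]) :
  (n <= N)%N -> (forall i, cmeasurable (g i)) ->
  (forall i, cintegrable P (fun w => g i (X i w))) ->
  cintegrable P (fun w => (\prod_(1 <= i < n.+1) W (X i w)) a b *
                          \prod_(n.+1 <= i < N.+1) g i (X i w)) /\
  cintegral P (fun w => (\prod_(1 <= i < n.+1) W (X i w)) a b *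
                        \prod_(n.+1 <= i < N.+1) g i (X i w)) =
  (mean_mx ^+ n) a b *
  \prod_(n.+1 <= i < N.+1) cintegral P (fun w => g i (X i w)).
Proof.
elim: n b g => [|n IHn] b g nN mg ig.
  under eq_fun do rewrite (@big_geq _ _ _ 1 1)// mxE.
  rewrite expr0 mxE; have [i1 e1] := cintegral_nat_prod N.+1 mg ig.
  by have [i2 ->] := cintegralZ ((a == b)%:R) i1; rewrite e1.
pose g' c i := if i == n.+1 then (fun y => W y c b) else g i.
have mg' c i : cmeasurable (g' c i) by rewrite /g'; case: eqP.
have cW c b' i := cintegral_id iidX.2 i (mW c b') (intW c b').
have ig' c i : cintegrable P (fun w => g' c i (X i w)).
  by rewrite /g'; case: eqP => // _; exact: (cW c b i).1.
have IH c := IHn c (g' c) (ltnW nN) (mg' c) (ig' c).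
have prodE c (F : nat -> (T' -> R[i]) -> R[i]) :
    \prod_(n.+1 <= i < N.+1) F i (g' c i) =
    F n.+1 (fun y => W y c b) * \prod_(n.+2 <= i < N.+1) F i (g i).
  rewrite big_ltn ?ltnS// /g' eqxx; congr (_ * _).
  by apply: eq_big_nat => i /andP[ni _]; rewrite gtn_eqF.
have [i1 e1] := cintegral_sum (index_enum 'I_l) (fun=> 1) (fun c => (IH c).1).
have -> : (fun w => (\prod_(1 <= i < n.+2) W (X i w)) a b *
                   \prod_(n.+2 <= i < N.+1) g i (X i w)) =
  (fun w => \sum_c 1 * ((\prod_(1 <= i < n.+1) W (X i w)) a c *
                          \prod_(n.+1 <= i < N.+1) g' c i (X i w))).
  apply/funext => w; rewrite big_nat_recr//= mxE mulr_suml.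
  apply: eq_bigr => c _.
  by rewrite mul1r (prodE c (fun i h => h (X i w))) mulrA.
split => //; rewrite e1 exprSr mxE mulr_suml; apply: eq_bigr => c _.
rewrite mul1r (IH c).2 (prodE c (fun i h => cintegral P (fun w => h (X i w)))).
by rewrite (cW c b n.+1).2 mulrA mxE.
Qed.

Lemma cintegral_mxprod (n : nat) (a b : 'I_l) :
  cintegrable P (fun w => (\prod_(1 <= i < n.+1) W (X i w)) a b) /\
  cintegral P (fun w => (\prod_(1 <= i < n.+1) W (X i w)) a b) =
  (mean_mx ^+ n) a b.
Proof.
have ig i : cintegrable P (fun w => W (X i w) a b).
  exact: (cintegral_id iidX.2 i (mW a b) (intW a b)).1.
have E : (fun w => (\prod_(1 <= i < n.+1) W (X i w)) a b) =
    (fun w => (\prod_(1 <= i < n.+1) W (X i w)) a b *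
              \prod_(n.+1 <= i < n.+1) W (X i w) a b).
  by apply/funext => w; rewrite [X in _ * X]big_geq// mulr1.
have := cintegral_mxprod_tail a b (leqnn n) (fun=> mW a b) ig.
by rewrite -E [X in _ = _ * X]big_geq// mulr1.
Qed.

End RandomMatrixProducts.

(** * Moments of products of random matrices *)

Section ProductMoments.
Context (R : realType) (disp : measure_display) (T : measurableType disp)
  (P : probability T R) (d k : nat) (X : nat -> {RV P >-> borel_mx R d}).

(** Convergence to 0 makes the tail expectation finite at some threshold [r]; off the tail the
    function is at most [r], and constants are integrable for a probability. *)
Lemma integrable_of_tail_moment :
  tail_moment k (X 0%N) r @[r --> +oo] --> 0%E ->
  P.-integrable setT (fun w => (hs_norm (X 0%N w : 'M[R[i]]_d) ^+ (2 * k))%:E).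
Proof.
move=> /fine_cvgP[fin _].
have [r rfin] := filter_ex fin.
pose h w := hs_norm (X 0%N w : 'M[R[i]]_d) ^+ (2 * k).
have mh : measurable_fun setT h.
  exact: (measurableT_comp (measurable_hs_norm (R:=R) (d:=d) k)).
pose D := [set w | r < h w].
have mD : measurable D.
  rewrite (_ : D = setT `&` h @^-1` `]r, +oo[).
    by apply: mh => //; exact: measurable_itv.
  by apply/seteqP; split => w /=; rewrite in_itv/= andbT; [|case].
have h0 w : 0 <= h w.
  by rewrite exprn_ge0// hs_norm_ge0.
have itail : P.-integrable setT (fun w => (h w * \1_D w)%:E).
  apply/integrableP; split.
    by apply/measurable_EFinP/measurable_funM.
  under eq_integral do rewrite gee0_abs ?lee_fin ?mulr_ge0//.
  move: rfin; rewrite /tail_moment unlock => rfin.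
  rewrite -ge0_fin_numE//.
  by apply: integral_ge0 => w _; rewrite lee_fin mulr_ge0.
(* The absolute value is taken because the threshold may be negative. *)
have icst : P.-integrable setT (EFin \o cst `|r|).
  exact: finite_measure_integrable_cst.
have := integrableD measurableT icst itail.
apply: le_integrable => //; first exact/measurable_EFinP.
move=> w _ /=; rewrite -/(h w) lee_fin ger0_norm// [leRHS]ger0_norm; last first.
  by rewrite addr_ge0// mulr_ge0.
rewrite indicE; have [rw|rw] := boolP (w \in D); first by rewrite mulr1 lerDr.
rewrite mulr0 addr0; apply: le_trans (ler_norm r).
by rewrite leNgt; apply/negP => rw'; move/negP: rw; apply; rewrite inE.
Qed.

Variables (m : nat) (e : 'I_d * 'I_d -> 'I_m.+1) (r : 'I_m.+1 -> 'I_d * 'I_d).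
Variable inv : 'M[R[i]]_d -> Prop.
Hypothesis iidX : iid X.
Hypothesis intX :
  P.-integrable setT (fun w => (hs_norm (X 0%N w : 'M[R[i]]_d) ^+ (2 * k))%:E).
Hypothesis inv1 : inv 1%:M.
Hypothesis inv_class : forall B, inv B -> class_invariant e r B.
Hypothesis inv_congr : forall n w B, inv B ->
  inv ((X n w : 'M[R[i]]_d) *m B *m (X n w : 'M[R[i]]_d) ^t*).

Let W (A : borel_mx R d) := transfer_mx k e r (A : 'M[R[i]]_d).

(** Pointwise, the power of the norm is a fixed linear combination of the entries of the product of
    the [W (X i w)]; expectations are then taken entry by entry. *)
Lemma product_moment_mxpow n :
  product_moment k X n \is a fin_num /\
  (fine (product_moment k X n))%:C =
  (trace_row R k e *m mean_mx X W ^+ n *m monomials k r 1%:M) 0 0.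
Proof.
have intW a b : cintegrable P (fun w => W (X 0%N w) a b).
  apply: (@le_cintegrable _ _ _ P _ (fun w =>
    (#|{ffun 'I_k -> 'I_d * 'I_d}|)%:R *
    hs_norm (X 0%N w : 'M[R[i]]_d) ^+ (2 * k))).
  - have [m1 m2] := @cmeasurable_transfer_mx R d k m e r a b.
    by split; [exact: (measurableT_comp m1)|exact: (measurableT_comp m2)].
  - by move=> w; exact: normr_transfer_mx_le.
  - rewrite /comp; under eq_fun do rewrite EFinM.
    exact: integrableZl.
have mW a b : cmeasurable (fun y => W y a b) by exact: cmeasurable_transfer_mx.
(* The coefficient of the entry at [a], [b] in the bilinear expression of row, matrix and column. *)
pose c a b := trace_row R k e 0 a * monomials k r 1%:M b 0.
have momE w :
  (hs_norm (\prod_(1 <= i < n.+1) (X i w : 'M[R[i]]_d)) ^+ (2 * k))%:C =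
    \sum_p c p.1 p.2 * (\prod_(1 <= i < n.+1) W (X i w)) p.1 p.2.
  (* The inserted identity is the matrix on which the congruences act. *)
  rewrite hs_norm_expM -[X in X *m _]mulmx1.
  have invP : inv ((\prod_(1 <= i < n.+1) (X i w : 'M[R[i]]_d)) *m 1%:M *m
      (\prod_(1 <= i < n.+1) (X i w : 'M[R[i]]_d)) ^t*).
    by apply: inv_congr_prod => // i B; exact: inv_congr.
  rewrite (trace_exp k (inv_class invP)).
  rewrite (monomials_congr_prod k n inv_class _ inv1); last first.
    by move=> i B; exact: inv_congr.
  rewrite mxE -(pair_bigA _ (fun a b => c a b *
    (\prod_(1 <= i < n.+1) W (X i w)) a b))/=.
  apply: eq_bigr => a _; rewrite [(_ *m monomials _ _ _) a 0]mxE mulr_sumr.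
  apply: eq_bigr => b _.
  by rewrite /c mulrAC mulrA.
have [iS eS] := cintegral_sum (index_enum _)
  (fun p => c p.1 p.2)
  (fun p => (cintegral_mxprod iidX mW intW n p.1 p.2).1).
rewrite -(funext momE) in iS eS.
have [iR _] := iS.
have finM : product_moment k X n \is a fin_num.
  by rewrite /product_moment unlock; exact: integrable_fin_num iR.
split => //.
transitivity (cintegral P (fun w =>
  (hs_norm (\prod_(1 <= i < n.+1) (X i w : 'M[R[i]]_d)) ^+ (2 * k))%:C)).
  by rewrite (cintegral_real_complex iR).2 /product_moment unlock.
rewrite eS -(pair_bigA _ (fun a b => c a b *
    cintegral P (fun w => (\prod_(1 <= i < n.+1) W (X i w)) a b)))/=.
rewrite -mulmxA [RHS]mxE; apply: eq_bigr => a _.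
rewrite [(_ *m monomials _ _ _) a 0]mxE mulr_sumr.
apply: eq_bigr => b _.
by rewrite (cintegral_mxprod iidX mW intW n a b).2 /c mulrAC mulrA.
Qed.

End ProductMoments.

(** The complex and real cases together: [s] sends a position to a canonical one in [D] carrying the
    same entry for all matrices in [inv], so the elements of [D] number the classes. *)
Lemma product_moment_recurrence (R : realType) (disp : measure_display)
    (T : measurableType disp) (P : probability T R) (d k : nat)
    (X : nat -> {RV P >-> borel_mx R d}) (inv : 'M[R[i]]_d -> Prop)
    (D : {set 'I_d * 'I_d}) (s : 'I_d * 'I_d -> 'I_d * 'I_d) :
  (1 <= d)%N -> iid X ->
  P.-integrable setT
    (fun w => (hs_norm (X 0%N w : 'M[R[i]]_d) ^+ (2 * k))%:E) ->
  inv 1%:M ->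
  (forall n w B, inv B ->
    inv ((X n w : 'M[R[i]]_d) *m B *m (X n w : 'M[R[i]]_d) ^t*)) ->
  (forall p, s p \in D) ->
  (forall B p, inv B -> B (s p).1 (s p).2 = B p.1 p.2) ->
  (forall n, product_moment k X n \is a fin_num) /\
  satisfies_linear_recurrence 'C(k + #|D| - 1, k)
    (fun n => (fine (product_moment k X n))%:C).
Proof.
move=> d0 iidX intX inv1 invX sD invs.
pose p0 : 'I_d * 'I_d := (Ordinal d0, Ordinal d0).
(* As [d] is positive, [D] is nonempty, and its cardinality has the successor form required of the
   number of classes. *)
have cardD : #|D| = #|D|.-1.+1.
  by rewrite prednK//; apply/card_gt0P; exists (s p0).
pose e p := cast_ord cardD (enum_rank_in (sD p0) (s p)).
pose r i : 'I_d * 'I_d := enum_val (cast_ord (esym cardD) i).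
have inv_class B : inv B -> class_invariant e r B.
  by move=> invB p; rewrite /r /e cast_ordK enum_rankK_in// invs.
have momE := product_moment_mxpow iidX intX inv1 inv_class invX.
split=> [n|]; first exact: (momE n).1.
have -> : (k + #|D| - 1 = k + #|D|.-1)%N by lia.
(* The binomial coefficient counts the sorted [k]-tuples of classes, that is, the size of the
   transfer matrix. *)
rewrite -card_sorted_tuples (funext (fun n => (momE n).2)).
exact: linear_recurrence_mxpow.
Qed.

Lemma card_ordered_pairs d :
  #|[set p : 'I_d * 'I_d | (p.1 <= p.2)%N]%SET| = 'C(d.+1, 2).
Proof.
rewrite -sum1_card; under eq_bigl do rewrite inE.
rewrite -(pair_big_dep xpredT (fun i j : 'I_d => (i <= j)%N)
  (fun _ _ => 1%N))/=.
rewrite (exchange_big_dep xpredT)//=.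
(* Counting by the larger coordinate [j], which leaves [j.+1] choices for the other, gives a
   triangular number. *)
transitivity (\sum_(j < d) j.+1)%N.
  apply: eq_bigr => j _.
  rewrite -(big_mkord (fun i => (i <= j)%N) (fun=> 1%N)).
  by rewrite -(big_nat_widen 0 j.+1 d xpredT)// sum_nat_const_nat subn0 muln1.
by rewrite -triangular_sum big_nat_recl// big_mkord add0n.
Qed.

Theorem theorem2 (R : realType) (disp : measure_display)
    (T : measurableType disp) (P : probability T R) (d k : nat)
    (X : nat -> {RV P >-> borel_mx R d}) :
  (1 <= d)%N -> (1 <= k)%N ->
  iid X ->
  tail_moment k (X 0%N) r @[r --> +oo] --> 0%E ->
  [/\ forall n : nat, (1 <= n)%N -> product_moment k X n \is a fin_num,
      satisfies_linear_recurrence 'C(k + d ^ 2 - 1, k)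
        (fun n => (fine (product_moment k X n))%:C) &
      (forall (n : nat) (w : T), (X n w : 'M[R[i]]_d) \is a realmx) ->
      satisfies_linear_recurrence 'C(k + 'C(d.+1, 2) - 1, k)
        (fun n => (fine (product_moment k X n))%:C)].
Proof.
move=> d0 k0 iidX /integrable_of_tail_moment intX.
(* Complex case: no relation between entries is imposed, and all [d ^ 2] positions are canonical. *)
have [fin rec] := @product_moment_recurrence R disp T P d k X (fun=> True)
  [set: _]%SET id d0 iidX intX I (fun _ _ _ _ => I)
  (fun p => finset.in_setT p) (fun _ _ _ => erefl).
split => [n _|| realX]; first exact: fin.
  by move: rec; rewrite cardsT card_prod card_ord mulnn.
rewrite -card_ordered_pairs.
(* Real case: the adjoint is the transpose, so congruences preserve symmetry, and positions below
   the diagonal are reflected above it. *)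
apply: (@product_moment_recurrence R disp T P d k X (fun B => B^T = B) _
  (fun p => if (p.1 <= p.2)%N then p else (p.2, p.1)) d0 iidX intX _ _ _ _).2.
- exact: trmx1.
- move=> n w B symB.
  have -> : (X n w : 'M[R[i]]_d) ^t* = (X n w : 'M[R[i]]_d)^T.
    by rewrite -map_trmx realmxC.
  by rewrite !trmx_mul trmxK symB mulmxA.
- by move=> p; rewrite inE; case: (leqP p.1 p.2) => //= /ltnW.
- move=> B p symB; case: ifP => // _ /=.
  by rewrite -[in LHS]symB mxE.
Qed.
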